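(* Let $k,d\ge 0$ be integers with $k+d\ge 1$, let $1\le p\le\infty$, and let $G$ be a graph with vertex set $\mathbb{Z}^k\times\mathbb{N}^d$ which is induced by the $p$-norm with constant $c<2$. Then the minimum edge-boundary is a monotonically increasing function of the volume: writing $f_G(n)=\min\{|\partial A| : A\subset \mathbb{Z}^k\times\mathbb{N}^d,\ |A|=n\}$, one has $f_G(n)\le f_G(n+1)$ for every $n\in\mathbb{N}$.
   Context: Here $\mathbb{N}=\{0,1,2,\dots\}$ in the vertex set. Graphs are simple and undirected. For a graph $G=(V(G),E(G))$ and a finite $A\subset V(G)$, the edge boundary of $A$ is $\partial A=\{e\in E(G): e=\{v,a\}\text{ for some } a\in A \text{ and } v\in V(G)\setminus A\}$. The volume of $A$ is $|A|$. A graph $G$ with $V(G)=\mathbb{Z}^k\times\mathbb{N}^d$ is induced by the $p$-norm with constant $c$ if for every $x\in V(G)$ the set of neighbours of $x$ is $\{y\in V(G): 0<\|x-y\|_p\le c\}$. ''Monotonically increasing'' is meant in the weak sense (non-decreasing). *)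

(* Defs.v *)
From HB Require Import structures.
From mathcomp Require Import all_boot all_order all_algebra finmap zify.
From mathcomp Require Import all_classical all_reals all_analysis.

Set Implicit Arguments.
Unset Strict Implicit.
Unset Printing Implicit Defensive.

Import Order.TTheory GRing.Theory Num.Theory.

Local Open Scope classical_set_scope.
Local Open Scope ring_scope.

Record sgraph (V : choiceType) := SGraph {
  adj :> rel V;
  adj_sym : symmetric adj;
  adj_irrefl : irreflexive adj }.

Section Boundary.
Variables (V : choiceType) (G : sgraph V).

Definition neighbours (x : V) : set V := [set y | adj G x y].

Definition edges : set {fset V} :=
  [set e | exists x y : V, adj G x y /\ e = [fset x; y]%fset].

Definition edge_boundary (A : {fset V}) : set {fset V} :=
  [set e | edges e /\
    exists v a : V, [/\ a \in A, v \notin A & e = [fset v; a]%fset]].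

(* A set A with infinite boundary contributes no value, so that it never
   realises the minimum. *)
Definition boundary_sizes (n : nat) : set nat :=
  [set m | exists A : {fset V},
    #|` A|%fset = n /\ (edge_boundary A #= `I_m)%card].

Definition is_minimum (S : set nat) (m : nat) : Prop := S m /\ lbound S m.

(* The value 0 is a default, taken only if no set of n vertices has a finite
   boundary; min_boundaryP rules this out for the graphs of interest. *)
Definition min_boundary (n : nat) : nat :=
  xget 0%N [set m | is_minimum (boundary_sizes n) m].

End Boundary.

Definition lattice (k d : nat) : Type :=
  ({ffun 'I_k -> int} * {ffun 'I_d -> nat})%type.
HB.instance Definition _ (k d : nat) := Choice.on (lattice k d).

Section PNorm.
Variable R : realType.

(* A norm only for 1 <= p <= +oo; the value at -oo is a dummy. *)
Definition pnorm (n : nat) (p : \bar R) (v : 'rV[R]_n) : R :=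
  match p with
  | r%:E => (\sum_(i < n) `|v 0 i| `^ r) `^ r^-1
  | +oo%E => \big[Num.max/0]_(i < n) `|v 0 i|
  | -oo%E => 0
  end.

Definition coords (k d : nat) (x : lattice k d) : 'rV[R]_(k + d) :=
  row_mx (\row_i (x.1 i)%:~R) (\row_j (x.2 j)%:R).

Definition induced_by_pnorm (k d : nat) (p : \bar R) (c : R)
    (G : sgraph (lattice k d)) : Prop :=
  forall x : lattice k d,
    neighbours G x =
      [set y | 0 < pnorm p (coords x - coords y) /\
               pnorm p (coords x - coords y) <= c].

End PNorm.

Lemma coord_le_pnorm (R : realType) (n : nat) (p : \bar R) (v : 'rV[R]_n)
    (i : 'I_n) : (1 <= p)%E -> `|v 0 i| <= pnorm p v.
Proof.
case: p => [r||] //=; last by move=> _; exact: (le_bigmax _ (fun i => `|v 0 i|)).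
rewrite lee_fin => r1; have r0 : r != 0 by rewrite gt_eqF// (lt_le_trans ltr01).
have ri0 : 0 <= r^-1 by rewrite invr_ge0 (le_trans ler01).
rewrite -[leLHS](powRr1 (normr_ge0 _)) -(mulfV r0) powRrM.
have S0 P : 0 <= \sum_(j < n | P j) `|v 0 j| `^ r.
  by apply: sumr_ge0 => j _; exact: powR_ge0.
apply: ge0_ler_powR; rewrite ?nnegrE ?powR_ge0 ?S0//.
by rewrite (bigD1 i) //= lerDl S0.
Qed.

Lemma finite_neighbours (R : realType) (k d : nat) (p : \bar R) (c : R)
    (G : sgraph (lattice k d)) :
  (1 <= p)%E -> c < 2 -> induced_by_pnorm p c G ->
  forall x, finite_set (neighbours G x).
Proof.
move=> p1 c2 HG x; rewrite HG.
pose f (t : {ffun 'I_k -> 'I_5} * {ffun 'I_d -> 'I_5}) : lattice k d :=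
  ([ffun i => x.1 i - 2 + (t.1 i : nat)%:Z], [ffun j => (x.2 j + t.2 j - 2)%N]).
apply: (@sub_finite_set _ _ (f @` setT)); last first.
  exact/finite_image/finite_finset.
move=> y /= [_ yc].
have {yc}C i : `|(coords R x - coords R y) 0 i| < 2.
  exact: le_lt_trans (le_trans (coord_le_pnorm _ _ p1) yc) c2.
have C1 (i : 'I_k) : `|x.1 i - y.1 i| < 2.
  have := C (lshift d i); rewrite /coords mxE [X in _ + X]mxE !row_mxEl !mxE.
  by rewrite -rmorphB/= -intr_norm (ltr_int R _ 2).
have C2 (j : 'I_d) : `|(x.2 j)%:Z - (y.2 j)%:Z| < 2.
  have := C (rshift k j); rewrite /coords mxE [X in _ + X]mxE !row_mxEr !mxE.
  by rewrite !pmulrn -rmorphB/= -intr_norm (ltr_int R _ 2).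
exists ([ffun i => inord (absz (y.1 i - x.1 i + 2))],
        [ffun j => inord (y.2 j + 2 - x.2 j)%N]) => //.
case: y C C1 C2 => [y1 y2] /= _ C1 C2.
congr pair; apply/ffunP => i; rewrite !ffunE inordK.
- by have := C1 i; rewrite ltr_norml; move: (x.1 i) (y1 i) => a b; lia.
- by have := C1 i; rewrite ltr_norml; move: (x.1 i) (y1 i) => a b; lia.
- by have := C2 i; rewrite ltr_norml; move: (x.2 i) (y2 i) => a b; lia.
- by have := C2 i; rewrite ltr_norml; move: (x.2 i) (y2 i) => a b; lia.
Qed.

Lemma finite_edge_boundary (V : choiceType) (G : sgraph V) :
  (forall x, finite_set (neighbours G x)) ->
  forall A, finite_set (edge_boundary G A).
Proof.
move=> fN A.
apply: (@sub_finite_set _ _ (\bigcup_(a in [set` A])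
   ((fun v => [fset v; a]%fset) @` neighbours G a))); last first.
  by apply: bigcup_finite => // a _; exact/finite_image.
move=> e [[x [y [xy Exy]]] [v [a [aA vA E]]]]; rewrite E in Exy *.
exists a => //=; exists v => //=.
have vna : v != a by apply: contraNneq vA => ->.
have: v \in [fset x; y]%fset by rewrite -Exy !inE eqxx.
have: a \in [fset x; y]%fset by rewrite -Exy !inE eqxx orbT.
rewrite !inE /neighbours/=.
by case/orP => /eqP aE /orP[] /eqP vE; move: xy vna;
  rewrite {}aE {}vE ?eqxx// adj_sym.
Qed.

Lemma exists_lattice_fset (k d n : nat) : (1 <= k + d)%N ->
  exists A : {fset lattice k d}, #|` A|%fset = n.
Proof.
move=> kd; pose f (m : nat) : lattice k d := ([ffun=> m%:Z], [ffun=> m]).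
exists [fset x in map f (iota 0 n)]%fset.
rewrite card_fseq undup_id ?size_map ?size_iota// map_inj_uniq ?iota_uniq//.
move=> a b [/ffunP h1 /ffunP h2].
case: k kd @f h1 => [|k] kd f h1.
  by case: d kd h2 {h1 f} => // d _ /(_ ord0); rewrite !ffunE.
by have := h1 ord0; rewrite !ffunE => -[].
Qed.

Lemma min_boundaryP (R : realType) (k d : nat) (p : \bar R) (c : R)
    (G : sgraph (lattice k d)) :
  (1 <= k + d)%N -> (1 <= p)%E -> c < 2 -> induced_by_pnorm p c G ->
  forall n, is_minimum (boundary_sizes G n) (min_boundary G n).
Proof.
move=> kd p1 c2 HG n; apply: (@xgetPex _ 0%N [set m | is_minimum _ m]).
have [A An] := exists_lattice_fset n kd.
have /finite_setP[m Am] :=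
  finite_edge_boundary (finite_neighbours p1 c2 HG) A.
have exS : exists m, `[< boundary_sizes G n m >].
  by exists m; apply/asboolP; exists A.
case: (ex_minnP exS) => q /asboolP Sq qmin; exists q; split=> // j Sj.
exact/qmin/asboolP.
Qed.

(* Main.v *)
Require Import Defs.
From mathcomp Require Import all_boot all_order all_algebra.
From mathcomp Require Import all_classical all_reals all_analysis.
From mathcomp Require Import finmap zify ring.
Import Order.TTheory GRing.Theory Num.Theory.
Local Open Scope ring_scope.

(** The minimum cannot rise from [n.+1] to [n] vertices because some vertex of
    an optimal set [A] of [n.+1] vertices can be deleted without enlarging the
    boundary: one with at least as many neighbours outside [A] as inside.

    A vertex [v] of [A] farthest from the origin in the Euclidean norm is such
    a vertex.  In [Z^k] this is the parallelogram law: the point reflection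
    [w |-> 2 v - w] preserves the neighbourhood of [v], and
    [|w|^2 + |2 v - w|^2 = 2 |v|^2 + 2 |w - v|^2 > 2 |v|^2] for [w != v], so
    [w] and its reflection are not both at distance at most [|v|] from the
    origin, hence not both in [A].  Where a coordinate is confined to [N] the
    reflection may become negative; that coordinate is then kept unchanged.
    The resulting map [reflect_lattice v] is still an involution that preserves the
    absolute differences of coordinates with [v], hence the p-norm distance
    to [v] ([adj_reflect]), and the parallelogram law survives as an inequality
    ([parallelogram_reflect]).  So [reflect_lattice v] sends the neighbours of [v] in
    [A] injectively to neighbours outside [A], and [card_edge_boundaryD1] turns
    this into an injection between edge boundaries. *)

(** Deleting [v] trades the boundary edges at [v] for the edges from [v] into
    [A]; [s] maps the latter injectively to the former, and every other
    boundary edge is kept. *)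
Lemma card_edge_boundaryD1 (V : choiceType) (G : sgraph V) (A : {fset V})
    (v : V) (s : V -> V) :
  v \in A -> involutive s -> s v = v ->
  (forall w, adj G v w -> adj G v (s w)) ->
  (forall w, adj G v w -> w \in A -> s w \notin A) ->
  (edge_boundary G (A `\ v)%fset #<= edge_boundary G A)%card.
Proof.
move=> vA sK sv sG sA.
(* [s] fixes [v], so [g] sends an edge [{v, w}] to [{v, s w}]. *)
pose g (e : {fset V}) := if v \in e then [fset s x | x in e]%fset else e.
have gK : involutive g.
  move=> e; rewrite /g; case: (boolP (v \in e)) => [ve|/negPf->//].
  have -> : v \in [fset s x | x in e]%fset by apply/imfsetP; exists v.
  apply/fsetP => x; apply/imfsetP/idP => [[_ /imfsetP[y ye ->] ->]|xe].
    by rewrite sK.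
  by exists (s x); rewrite ?sK//; apply/imfsetP; exists x.
apply: card_le_trans (card_ge_preimage (f := g) _); last first.
  by move=> e f _ _; exact: (inv_inj gK).
apply: subset_card_le => e [[x [y [xy Exy]]] [u [a [aB uB E]]]] /=.
have ua : adj G u a.
  have una : u != a by apply: contraNneq uB => ->.
  have: u \in [fset x; y]%fset by rewrite -Exy E !inE eqxx.
  have: a \in [fset x; y]%fset by rewrite -Exy E !inE eqxx orbT.
  rewrite !inE.
  by case/orP => /eqP aE /orP[] /eqP uE; move: xy una;
    rewrite {}aE {}uE ?eqxx// adj_sym.
(* [u] lies outside [A] unless it is the deleted vertex. *)
move: aB uB; rewrite !inE => /andP[av aA].
rewrite negb_and negbK => uvA.
rewrite /g E !inE [v == a]eq_sym (negPf av) orbF.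
have [uv|uv] := eqVneq v u; last first.
  have uA : u \notin A by move: uvA; rewrite eq_sym (negPf uv).
  by split; [exists u, a | exists u, a].
have -> : [fset s x | x in [fset u; a]]%fset = [fset s a; v]%fset.
  apply/fsetP => z; rewrite !inE -uv; apply/imfsetP/orP.
    by move=> [t]; rewrite !inE => /orP[] /eqP-> ->; rewrite ?sv eqxx; auto.
  by move=> [] /eqP->; [exists a | exists v]; rewrite ?sv// !inE eqxx ?orbT.
have va : adj G v a by rewrite uv.
split; last by exists (s a), v; split => //; exact: sA.
by exists (s a), v; split => //; rewrite adj_sym; exact: sG.
Qed.

(** The point reflection through [a], made an involution of [N] by fixing the
    points whose image would be negative. *)
Definition reflectn (a b : nat) : nat :=
  if (b <= a + a)%N then (a + a - b)%N else b.

Definition reflect_lattice {k d : nat} (v w : lattice k d) : lattice k d :=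
  ([ffun i => v.1 i + v.1 i - w.1 i], [ffun j => reflectn (v.2 j) (w.2 j)]).

Lemma reflectnK (a : nat) : involutive (reflectn a).
Proof.
by move=> b; rewrite /reflectn; case: (leqP b (a + a)) => ?; case: leqP; lia.
Qed.

Lemma reflectn_id (a : nat) : reflectn a a = a.
Proof. by rewrite /reflectn leq_addr addnK. Qed.

Lemma dist_reflectn (a b : nat) :
  `|a%:Z - (reflectn a b)%:Z| = `|a%:Z - b%:Z|.
Proof. by rewrite /reflectn; case: leqP; lia. Qed.

(** An equality if [b <= 2 a]; otherwise [b] is kept, and the difference of
    the two sides is [4 a (b - a)]. *)
Lemma parallelogram_reflectn (a b : nat) :
  (a%:Z ^+ 2 + (a%:Z - b%:Z) ^+ 2) *+ 2 <= b%:Z ^+ 2 + (reflectn a b)%:Z ^+ 2.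
Proof.
rewrite /reflectn; case: leqP => ab.
  by rewrite -subzn// PoszD le_eqVlt; apply/orP; left; apply/eqP; ring.
have ab' : 0 <= a%:Z * (b%:Z - a%:Z) by apply: mulr_ge0; lia.
by rewrite -subr_ge0 [leRHS](_ : _ = 4 * (a%:Z * (b%:Z - a%:Z))); [lia|ring].
Qed.

Lemma eq_pnorm (R : realType) (n : nat) (p : \bar R) (u v : 'rV[R]_n) :
  (forall i, `|u 0 i| = `|v 0 i|) -> pnorm p u = pnorm p v.
Proof.
by move=> uv; case: p => [r||] //=; [congr powR|]; apply: eq_bigr => i _;
  rewrite uv.
Qed.

Section Reflection.
Context {k d : nat}.
Implicit Types v w : lattice k d.

Lemma reflect_latticeK v : involutive (reflect_lattice v).
Proof.
by case: v => v1 v2 [w1 w2]; congr pair; apply/ffunP => i;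
  rewrite !ffunE ?reflectnK//= subKr.
Qed.

Lemma reflect_lattice_id v : reflect_lattice v v = v.
Proof.
by case: v => v1 v2; congr pair; apply/ffunP => i;
  rewrite !ffunE ?reflectn_id//= addrK.
Qed.

Definition sqnorm v : int :=
  \sum_i v.1 i ^+ 2 + \sum_j (v.2 j)%:Z ^+ 2.

Definition sqdist v w : int :=
  \sum_i (v.1 i - w.1 i) ^+ 2 + \sum_j ((v.2 j)%:Z - (w.2 j)%:Z) ^+ 2.

Lemma sqdist_gt0 {v w} : v != w -> 0 < sqdist v w.
Proof.
apply: contraNT; rewrite -leNgt => vw.
have [S1 S2] : 0 <= \sum_i (v.1 i - w.1 i) ^+ 2 /\
    0 <= \sum_j ((v.2 j)%:Z - (w.2 j)%:Z) ^+ 2.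
  by split; apply: sumr_ge0 => i _; exact: sqr_ge0.
have /eqP : sqdist v w = 0 by apply/le_anti; rewrite vw addr_ge0.
rewrite paddr_eq0// !psumr_eq0; do ?by move=> i _; exact: sqr_ge0.
move=> /andP[/allP E1 /allP E2]; apply/eqP.
case: v w {vw S1 S2} E1 E2 => [v1 v2] [w1 w2] /= E1 E2.
congr pair; apply/ffunP => i.
  by have := E1 i (mem_index_enum i); rewrite sqrf_eq0 subr_eq0 => /eqP.
by have := E2 i (mem_index_enum i); rewrite sqrf_eq0 subr_eq0 => /eqP[].
Qed.

Lemma parallelogram_reflect v w :
  (sqnorm v + sqdist v w) *+ 2 <= sqnorm w + sqnorm (reflect_lattice v w).
Proof.
rewrite /sqnorm /sqdist addrACA [leRHS]addrACA -!big_split/=.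
rewrite mulrnDl -!sumrMnl; apply: lerD; apply: ler_sum => i _; rewrite ffunE.
  by rewrite le_eqVlt; apply/orP; left; apply/eqP; ring.
exact: parallelogram_reflectn.
Qed.

Variable R : realType.

Lemma pnorm_reflect (p : \bar R) v w :
  pnorm p (coords R v - coords R (reflect_lattice v w)) =
  pnorm p (coords R v - coords R w).
Proof.
apply: eq_pnorm => i; rewrite /coords !mxE.
case: (fintype.split i) => j; rewrite !mxE !ffunE.
  by rewrite -!rmorphB/= -!intr_norm distrC; congr (`|_|%:~R); ring.
by rewrite !pmulrn -!rmorphB/= -!intr_norm dist_reflectn.
Qed.

Lemma adj_reflect (p : \bar R) (c : R) (G : sgraph (lattice k d)) v w :
  induced_by_pnorm p c G -> adj G v w -> adj G v (reflect_lattice v w).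
Proof.
move=> /(_ v) GE vw; change (neighbours G v (reflect_lattice v w)).
have : neighbours G v w := vw.
by rewrite GE/= pnorm_reflect.
Qed.

(** The reflection and [w] both lying in [A] would contradict the parallelogram law, as neither
    is farther from the origin than [v]. *)
Lemma reflect_notin (A : {fset lattice k d}) v w :
  (forall x, x \in A -> sqnorm x <= sqnorm v) -> v != w -> w \in A ->
  reflect_lattice v w \notin A.
Proof.
move=> vmax vw wA; apply/negP => /vmax rv; have := vmax _ wA.
by have := parallelogram_reflect v w; have := sqdist_gt0 vw; lia.
Qed.

End Reflection.

Lemma exists_farthest (k d : nat) (A : {fset lattice k d}) :
  (0 < #|` A|)%N ->
  exists2 v, v \in A & forall x, x \in A -> sqnorm x <= sqnorm v.
Proof.
rewrite cardfs_gt0 => /fset0Pn[x0 x0A].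
have [v _ vmax] :=
  @arg_maxP _ _ _ [` x0A]%fset xpredT (fun x : A => sqnorm (val x)) isT.
by exists (val v) => [|x xA]; [exact: valP | exact: (vmax [` xA]%fset)].
Qed.

Theorem theorem2 (R : realType) (k d : nat) (p : \bar R) (c : R)
    (G : sgraph (lattice k d)) :
  (1 <= k + d)%N -> (1 <= p)%E -> c < 2 -> induced_by_pnorm p c G ->
  forall n : nat, (min_boundary G n <= min_boundary G n.+1)%N.
Proof.
move=> kd p1 c2 HG n.
have [[A [An Am]] _] := min_boundaryP kd p1 c2 HG n.+1.
have [_ minB] := min_boundaryP kd p1 c2 HG n.
have [v vA vmax] : exists2 v, v \in A &
    forall x, x \in A -> sqnorm x <= sqnorm v.
  by apply: exists_farthest; rewrite An.
have BA : (edge_boundary G (A `\ v)%fset #<= edge_boundary G A)%card.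
  apply: (@card_edge_boundaryD1 _ _ _ _ (reflect_lattice v)) => //.
  - exact: reflect_latticeK.
  - exact: reflect_lattice_id.
  - by move=> w; exact: adj_reflect HG.
  - move=> w vw; apply: reflect_notin vmax _.
    by apply: contraTneq vw => <-; rewrite adj_irrefl.
have /finite_setP[q Bq] : finite_set (edge_boundary G (A `\ v)%fset).
  by apply: card_le_finite BA _; apply/finite_setP; exists (min_boundary G n.+1).
apply: (@leq_trans q).
  apply: minB; exists (A `\ v)%fset; split=> //.
  by apply/eqP; rewrite -eqSS -An (cardfsD1 v A) vA.
by rewrite -card_le_II -(card_le_eql Bq) -(card_le_eqr Am).
Qed.
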